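(* Let $\mathcal{T}$ be an injective nondeterministic finite transducer mapping $\Sigma^*$ to $\Omega^*$. Then, for every grammar with left contexts $G$ over the alphabet $\Sigma$, there exists a grammar with left contexts $G'$ over the alphabet $\Omega$ that defines the language $L(G')=\mathcal{T}(L(G))$, where $\mathcal{T}(L)=\bigcup_{w\in L}\mathcal{T}(w)$.
   Context: **Grammars with left contexts.** A grammar with left contexts (also: grammar with left context operators) is a quadruple $G=(\Sigma,N,R,S)$, where $\Sigma$ is a finite alphabet, $N$ is a finite set of nonterminal symbols disjoint from $\Sigma$, $S\in N$ is the initial symbol, and $R$ is a finite set of rules of the form $$A\to \alpha_1\,\&\,\ldots\,\&\,\alpha_k\,\&\,{\lhd}\beta_1\,\&\,\ldots\,\&\,{\lhd}\beta_m\,\&\,{\trianglelefteq}\gamma_1\,\&\,\ldots\,\&\,{\trianglelefteq}\gamma_n,$$ with $A\in N$, $k\ge 1$, $m,n\ge 0$, $\alpha_i,\beta_i,\gamma_i\in(\Sigma\cup N)^*$. For $u,v\in\Sigma^*$, write $u\langle v\rangle$ for the string $v$ in the left context $u$ (formally a pair $(u,v)$). Propositions $X(u\langle v\rangle)$, with $X\in\Sigma\cup N$, are derived as follows. Axioms: $a(x\langle a\rangle)$ for all $a\in\Sigma$, $x\in\Sigma^*$. Each rule $A\to \alpha_1\,\&\,\ldots\,\&\,\alpha_k\,\&\,{\lhd}\beta_1\,\&\,\ldots\,\&\,{\lhd}\beta_m\,\&\,{\trianglelefteq}\gamma_1\,\&\,\ldots\,\&\,{\trianglelefteq}\gamma_n$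 in $R$ allows one to derive $A(u\langle v\rangle)$ from already derived propositions if: (i) for every conjunct $\alpha_i=X_1\ldots X_\ell$ there is a partition $v=v_1\ldots v_\ell$ such that $X_j(uv_1\ldots v_{j-1}\langle v_j\rangle)$ is derived for all $j$; (ii) for every conjunct ${\lhd}\beta_i={\lhd}X_1\ldots X_\ell$ there is a partition $u=u_1\ldots u_\ell$ such that $X_j(u_1\ldots u_{j-1}\langle u_j\rangle)$ is derived for all $j$; (iii) for every conjunct ${\trianglelefteq}\gamma_i={\trianglelefteq}X_1\ldots X_\ell$ there is a partition $uv=w_1\ldots w_\ell$ such that $X_j(w_1\ldots w_{j-1}\langle w_j\rangle)$ is derived for all $j$. For $\ell=0$ these conditions mean $v=\varepsilon$, $u=\varepsilon$, $uv=\varepsilon$, respectively. The language described by $G$ is $L(G)=\{w\in\Sigma^*\mid S(\varepsilon\langle w\rangle)\text{ is derivable}\}$. **Transducers.** A nondeterministic finite transducer (NFT) is a sextuple $\mathcal{T}=(\Sigma,\Omega,Q,Q_0,\delta,F)$ with finite non-empty input alphabet $\Sigma$, output alphabet $\Omega$ and set of states $Q$, initial states $Q_0\subseteq Q$, accepting states $F\subseteq Q$, and a finite transition relation $\delta\subseteq Q\times(\Sigma\cup\{\varepsilon\})\times(\Omega\cup\{\varepsilon\})\times Q$. A computation from $p_0$ to $p_\ell$ ($\ell\ge0$) is a sequence of transitions $(p_{i-1},u_i,x_i,p_i)\in\delta$, $i=1,\ldots,\ell$; it reads $u_1\ldots u_\ell$ and emits $x_1\ldots x_\ell$; its existence is denoted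 by $p_0\xrightarrow{u_1\ldots u_\ell/x_1\ldots x_\ell}p_\ell$. For $w\in\Sigma^*$, $\mathcal{T}(w)=\{z\in\Omega^*\mid q_0\xrightarrow{w/z}q\text{ for some }q_0\in Q_0,\ q\in F\}$. The NFT is injective if $\mathcal{T}(w)\cap\mathcal{T}(w')=\varnothing$ for every two distinct strings $w,w'\in\Sigma^*$. *)

(* Defs.v *)
From HB Require Import structures.
From mathcomp Require Import all_boot.

Set Implicit Arguments.
Unset Strict Implicit.
Unset Printing Implicit Defensive.

(* A terminal is [inl a], a nonterminal is [inr A]: the two alphabets are
   disjoint by construction. *)
Notation symbol Sigma N := (Sigma + N)%type (only parsing).

(* A -> alpha_1 & .. & alpha_k & <|beta_1 & .. & <|beta_m
          & <=|gamma_1 & .. & <=|gamma_n *)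
Record rule (Sigma N : finType) := Rule {
  lhs : N;
  base_conjs : seq (seq (symbol Sigma N));   (* the alpha_i *)
  left_conjs : seq (seq (symbol Sigma N));  (* the beta_i *)
  extleft_conjs : seq (seq (symbol Sigma N)) (* the gamma_i *)
}.

Section RuleEq.
Variables Sigma N : finType.
Let enc (r : rule Sigma N) := (lhs r, base_conjs r, left_conjs r, extleft_conjs r).
Let dec t : rule Sigma N := let: (A, al, be, ga) := t in Rule A al be ga.
Let encK : cancel enc dec. Proof. by case. Qed.
HB.instance Definition _ := Equality.copy (rule Sigma N) (can_type encK).
End RuleEq.

Record grammar (Sigma : finType) := Grammar {
  nonterminal : finType;
  rules : seq (rule Sigma nonterminal);
  start : nonterminal;
  base_gt0 : forall r, r \in rules -> 0 < size (base_conjs r)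
}.

(* [derivable G X u v] is the derivability of the proposition X(u<v>).
   In each of the three conjunct conditions, the tuple [vs] is a partition,
   possibly with empty parts, of the relevant string into as many parts as
   the conjunct has symbols; in the last two, the first part has an empty
   left context. *)
Inductive derivable (Sigma : finType) (G : grammar Sigma) :
    symbol Sigma (nonterminal G) -> seq Sigma -> seq Sigma -> Prop :=
| derivable_axiom (a : Sigma) (x : seq Sigma) :
    derivable (inl a) x [:: a]
| derivable_rule (r : rule Sigma (nonterminal G)) (u v : seq Sigma) :
    r \in rules G ->
    (forall alpha, alpha \in base_conjs r ->
       exists vs : (size alpha).-tuple (seq Sigma),
         v = flatten vs /\
         forall j : 'I_(size alpha),
           derivable (tnth (in_tuple alpha) j)
             (u ++ flatten (take j vs)) (tnth vs j)) ->
    (forall beta, beta \in left_conjs r ->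
       exists vs : (size beta).-tuple (seq Sigma),
         u = flatten vs /\
         forall j : 'I_(size beta),
           derivable (tnth (in_tuple beta) j)
             (flatten (take j vs)) (tnth vs j)) ->
    (forall gamma, gamma \in extleft_conjs r ->
       exists vs : (size gamma).-tuple (seq Sigma),
         u ++ v = flatten vs /\
         forall j : 'I_(size gamma),
           derivable (tnth (in_tuple gamma) j)
             (flatten (take j vs)) (tnth vs j)) ->
    derivable (inr (lhs r)) u v.

Definition language (Sigma : finType) (G : grammar Sigma) (w : seq Sigma) :
  Prop := @derivable Sigma G (inr (start G)) [::] w.

(* In a transition (p, a, x, q), [None] as a label stands for epsilon. *)
Record nft (Sigma Omega : finType) := NFT {
  state : finType;
  initial : {set state};
  delta : {set state * option Sigma * option Omega * state};
  accepting : {set state};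
  input_nonempty : 0 < #|Sigma|;
  output_nonempty : 0 < #|Omega|;
  state_nonempty : 0 < #|state|
}.

Section Transducers.
Variables (Sigma Omega : finType) (T : nft Sigma Omega).

Definition transition : Type :=
  state T * option Sigma * option Omega * state T.

Fixpoint computation (p : state T) (ts : seq transition) (q : state T) : bool :=
  match ts with
  | [::] => p == q
  | t :: ts' =>
      [&& t \in delta T, t.1.1.1 == p & computation t.2 ts' q]
  end.

Definition reads (ts : seq transition) : seq Sigma :=
  pmap (fun t : transition => t.1.1.2) ts.

Definition emits (ts : seq transition) : seq Omega :=
  pmap (fun t : transition => t.1.2) ts.

Definition transduces (p : state T) (w : seq Sigma) (z : seq Omega)
    (q : state T) : Prop :=
  exists ts, [/\ computation p ts q, reads ts = w & emits ts = z].

(* [output w z] means that z belongs to T(w). *)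
Definition output (w : seq Sigma) (z : seq Omega) : Prop :=
  exists q0 q, [/\ q0 \in initial T, q \in accepting T & transduces q0 w z q].

Definition nft_injective : Prop :=
  forall w w' : seq Sigma, w <> w' -> forall z, ~ (output w z /\ output w' z).

Definition nft_image (L : seq Sigma -> Prop) (z : seq Omega) : Prop :=
  exists w, L w /\ output w z.

End Transducers.

(* Main.v *)
(* Injectivity makes the decoding local: if q can still reach an accepting
   state, then the input u read on a way from an initial state to q while
   emitting x is determined by x and q; hence, once p is reached with x, so is
   the input v read between p and q while emitting y.  Therefore let the
   nonterminal A_{p,q} of G' define y in the left context x whenever A defines
   v in the left context u for these decodings.  Every conjunct is translated
   by guessing the states of the transducer between its symbols; uniqueness of
   the decoding ensures that all conjuncts of a rule talk about the same u
   and v. *)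
Require Import Defs.
From mathcomp Require Import all_boot.

Set Implicit Arguments.
Unset Strict Implicit.
Unset Printing Implicit Defensive.

(** * Recursive form of the partition conditions on conjuncts *)

Section WordHolds.
Variables (S Y : Type).
Implicit Types (P : Y -> seq S -> seq S -> Prop) (ys : seq Y).

(** Replaces the tuple of parts by recursion on the word. The left context grows with every part
    consumed, so conjuncts can be treated by induction. *)
Fixpoint word_holds P u ys v : Prop :=
  if ys is y :: ys' then
    exists v1 v2, [/\ v = v1 ++ v2, P y u v1 & word_holds P (u ++ v1) ys' v2]
  else v = [::].

Lemma word_holds_tuple P u ys v :
  word_holds P u ys v <->
  exists vs : (size ys).-tuple (seq S),
    v = flatten vs /\
    forall j : 'I_(size ys),
      P (tnth (in_tuple ys) j) (u ++ flatten (take j vs)) (tnth vs j).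
Proof.
elim: ys u v => [|y ys IH] u v /=.
  split=> [->|[vs [-> _]]]; first by exists [tuple]; split=> // -[].
  by rewrite (tuple0 vs).
split.
  move=> [v1 [v2 [-> Hy /IH[vs [-> Hvs]]]]].
  exists [tuple of v1 :: vs]; split=> // j.
  case: (unliftP ord0 j) => [i ->|->] /=.
    by have := Hvs i; rewrite !(tnth_nth y) !(tnth_nth [::]) /= catA.
  by rewrite !(tnth_nth y) !(tnth_nth [::]) /= cats0.
case=> vs; case/tupleP: vs => v1 vs [-> Hvs].
exists v1, (flatten vs); split=> //.
  by have := Hvs ord0; rewrite !(tnth_nth y) !(tnth_nth [::]) /= cats0.
apply/IH; exists vs; split=> // i.
by have := Hvs (lift ord0 i); rewrite !(tnth_nth y) !(tnth_nth [::]) /= catA.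
Qed.

Lemma word_holds_nil_tuple P ys v :
  word_holds P [::] ys v <->
  exists vs : (size ys).-tuple (seq S),
    v = flatten vs /\
    forall j : 'I_(size ys),
      P (tnth (in_tuple ys) j) (flatten (take j vs)) (tnth vs j).
Proof. exact: word_holds_tuple. Qed.

Lemma word_holds_sub P P' u ys v :
  (forall y u' v', P y u' v' -> P' y u' v') ->
  word_holds P u ys v -> word_holds P' u ys v.
Proof.
move=> PP'; elim: ys u v => //= y ys IH u v [v1 [v2 [-> /PP' H /IH H']]].
by exists v1, v2.
Qed.

End WordHolds.

(** * Rule application and induction on derivations *)

Section Derivability.
Variables (S : finType) (G : grammar S).
Local Notation sym := (symbol S (nonterminal G)).

Lemma derivable_by_rule (r : rule S (nonterminal G)) u v :
  r \in rules G ->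
  (forall a, a \in base_conjs r -> word_holds (@derivable S G) u a v) ->
  (forall b, b \in left_conjs r -> word_holds (@derivable S G) [::] b u) ->
  (forall c, c \in extleft_conjs r ->
     word_holds (@derivable S G) [::] c (u ++ v)) ->
  derivable (inr (lhs r) : sym) u v.
Proof.
move=> rG Hb Hl He; apply: derivable_rule => //.
- by move=> a /Hb/word_holds_tuple.
- by move=> b /Hl/word_holds_nil_tuple.
- by move=> c /He/word_holds_nil_tuple.
Qed.

(* The automatically generated principle has no induction hypotheses for the
   derivations nested under the existential quantifiers. *)
Lemma derivable_nested_ind (P : sym -> seq S -> seq S -> Prop) :
  let DP X u v := derivable X u v /\ P X u v in
  (forall a x, P (inl a) x [:: a]) ->
  (forall (r : rule S (nonterminal G)) u v, r \in rules G ->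
    (forall a, a \in base_conjs r -> word_holds DP u a v) ->
    (forall b, b \in left_conjs r -> word_holds DP [::] b u) ->
    (forall c, c \in extleft_conjs r -> word_holds DP [::] c (u ++ v)) ->
    P (inr (lhs r)) u v) ->
  forall X u v, derivable X u v -> P X u v.
Proof.
move=> DP Hax Hrule; fix IH 4 => X u v [a x|r x y rG Hb Hl He].
  exact: Hax.
apply: Hrule => //.
- move=> a /Hb[vs [-> H]]; apply/word_holds_tuple.
  by exists vs; split=> // j; split; [exact: H | exact: IH (H j)].
- move=> b /Hl[vs [-> H]]; apply/word_holds_nil_tuple.
  by exists vs; split=> // j; split; [exact: H | exact: IH (H j)].
- move=> c /He[vs [-> H]]; apply/word_holds_nil_tuple.
  by exists vs; split=> // j; split; [exact: H | exact: IH (H j)].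
Qed.

End Derivability.

(** * Choosing one translation for each conjunct *)

Fixpoint choices (T : Type) (ss : seq (seq T)) : seq (seq T) :=
  if ss is s :: ss' then [seq x :: xs | x <- s, xs <- choices ss'] else [:: [::]].

Lemma size_choices (T : eqType) (ss : seq (seq T)) xs :
  xs \in choices ss -> size xs = size ss.
Proof.
elim: ss xs => [|s ss IH] xs /=; first by rewrite inE => /eqP->.
by case/allpairsP=> -[x ys] /= [_ /IH <- ->].
Qed.

(** Gathers translations found separately for each conjunct into one list, hence into one rule of
    the image grammar, and back. *)
Lemma choicesP (A T : eqType) (f : A -> seq T) (Q : T -> Prop) (s : seq A) :
  (forall a, a \in s -> exists2 x, x \in f a & Q x) <->
  (exists2 xs, xs \in choices (map f s) & forall x, x \in xs -> Q x).
Proof.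
elim: s => [|a s IH] /=.
  by split=> // _; exists [::]; rewrite ?inE.
split.
  move=> H; have [x xfa Qx] := H a (mem_head a s).
  have /IH[xs xsP Qxs] : forall b, b \in s -> exists2 x, x \in f b & Q x.
    by move=> b bs; apply: H; rewrite inE bs orbT.
  exists (x :: xs); first exact: (allpairs_f cons).
  by move=> z; rewrite inE => /predU1P[->|/Qxs].
case=> zs /allpairsP[[x xs] /= [xfa xsP ->]] Q_xs b.
rewrite inE => /predU1P[->|].
  by exists x => //; apply: Q_xs; exact: mem_head.
apply: (proj2 IH); exists xs => // z zxs; apply: Q_xs.
by rewrite inE zxs orbT.
Qed.

(** * Concatenating and splitting computations *)

Section Transductions.
Variables (Sigma Omega : finType) (T : nft Sigma Omega).

Lemma transduces_nil (p : state T) : transduces p [::] [::] p.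
Proof. by exists [::]; rewrite /= eqxx. Qed.

Lemma computation_cat (p q : state T) ts1 ts2 :
  computation p (ts1 ++ ts2) q <->
  exists2 r, computation p ts1 r & computation r ts2 q.
Proof.
elim: ts1 p => [|t ts1 IH] p /=.
  by split=> [H|[r /eqP->]]; first exists p.
split.
  by case/and3P=> -> -> /IH[r H1 H2]; exists r.
by case=> r /and3P[-> -> H1] H2; apply/IH; exists r.
Qed.

Lemma transduces_cat (p q r : state T) w1 w2 z1 z2 :
  transduces p w1 z1 q -> transduces q w2 z2 r ->
  transduces p (w1 ++ w2) (z1 ++ z2) r.
Proof.
move=> [ts1 [H1 <- <-]] [ts2 [H2 <- <-]]; exists (ts1 ++ ts2).
by split; [apply/computation_cat; exists q | exact: pmap_cat..].
Qed.

Lemma reads_cons (t : transition T) ts :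
  reads (t :: ts) = seq_of_opt t.1.1.2 ++ reads ts.
Proof. by case: t => -[[p [a|]] b] q. Qed.

Lemma emits_cons (t : transition T) ts :
  emits (t :: ts) = seq_of_opt t.1.2 ++ emits ts.
Proof. by case: t => -[[p a] [b|]] q. Qed.

Lemma transduces_step (p q r : state T) a b w z :
  (p, a, b, q) \in delta T -> transduces q w z r ->
  transduces p (seq_of_opt a ++ w) (seq_of_opt b ++ z) r.
Proof.
move=> tT [ts [H <- <-]]; exists ((p, a, b, q) :: ts).
by rewrite reads_cons emits_cons /= tT eqxx.
Qed.

(** The cut is right after the transition reading the last symbol of [w1], or at the very start if
    [w1] is empty. Transitions reading epsilon after the cut fall to the second half. *)
Lemma transduces_split (p q : state T) w1 w2 z :
  transduces p (w1 ++ w2) z q ->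
  exists z1 z2 r,
    [/\ z = z1 ++ z2, transduces p w1 z1 r & transduces r w2 z2 q].
Proof.
case=> ts [Hts Hw <-]; elim: ts p w1 Hts Hw => [|t ts IH] p [|a w1] Hts.
- move=> /= <-; exists [::], [::], p; split=> //; first exact: transduces_nil.
  by exists [::].
- by [].
- move=> /= Hw; exists [::], (emits (t :: ts)), p; split=> //.
    exact: transduces_nil.
  by exists (t :: ts).
rewrite reads_cons emits_cons; case: t Hts => -[[p' [c|]] b] p1 /and3P[/= tT /eqP<- Hts]; last first.
  move=> /(IH _ (a :: w1) Hts)[z1 [z2 [r [Hz H1 H2]]]].
  exists (seq_of_opt b ++ z1), z2, r; split=> //.
    by rewrite Hz catA.
  exact: transduces_step tT H1.
case=> ca /(IH _ w1 Hts)[z1 [z2 [r [Hz H1 H2]]]].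
exists (seq_of_opt b ++ z1), z2, r; split=> //.
  by rewrite Hz catA.
rewrite -ca; exact: transduces_step tT H1.
Qed.

(** * Unique decoding for an injective transducer *)

Definition reached u x (p : state T) : Prop :=
  exists2 q0, q0 \in initial T & transduces q0 u x p.

Definition productive (q : state T) : Prop :=
  exists t s, exists2 f, f \in accepting T & transduces q t s f.

Lemma reached_cat u x p v y q :
  reached u x p -> transduces p v y q -> reached (u ++ v) (x ++ y) q.
Proof. by case=> q0 ? H ?; exists q0 => //; exact: transduces_cat H _. Qed.

Lemma reached_nil q0 : q0 \in initial T -> reached [::] [::] q0.
Proof. by exists q0 => //; exact: transduces_nil. Qed.

Lemma productive_pred p v y q :
  transduces p v y q -> productive q -> productive p.
Proof.
move=> H [t [s [f fF Hf]]]; exists (v ++ t), (y ++ s), f => //.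
exact: transduces_cat Hf.
Qed.

Hypothesis T_inj : nft_injective T.

(** One accepting computation from [q] extends both runs: [u ++ t] and [u' ++ t] then share the
    output [x ++ s]. *)
Lemma reached_inj u u' x q :
  reached u x q -> reached u' x q -> productive q -> u = u'.
Proof.
move=> [q0 I0 H0] [q1 I1 H1] [t [s [f fF Hf]]].
apply/eqP; case: eqP => // ne.
case: (T_inj (w := u ++ t) (w' := u' ++ t) _ (z := x ++ s)).
  (* The common suffix [t] is cancelled as a prefix of the reversals. *)
  move/(congr1 (fun s => drop (size t) (rev s))).
  by rewrite !rev_cat !drop_size_cat ?size_rev // => /(can_inj revK).
split; [exists q0, f | exists q1, f]; split=> //.
  exact: transduces_cat H0 Hf.
exact: transduces_cat H1 Hf.
Qed.

Lemma transduces_inj u x p v v' y q :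
  reached u x p -> productive q ->
  transduces p v y q -> transduces p v' y q -> v = v'.
Proof.
move=> Hp Hq Hv Hv'.
have := reached_inj (reached_cat Hp Hv) (reached_cat Hp Hv') Hq.
by move/(congr1 (drop (size u))); rewrite !drop_size_cat.
Qed.

End Transductions.

(** * Construction of the image grammar *)

Section ImageGrammar.
Variables (Sigma Omega : finType) (T : nft Sigma Omega) (G : grammar Sigma).
Local Notation Q := (state T).
Local Notation N := (nonterminal G).

(* [None] is the new initial symbol.  [Some (inl o, p, q)] defines all strings
   emitted from p to q while reading the at most one symbol o, in any left
   context; [Some (inr A, p, q)] is A_{p,q}. *)
Definition image_nonterminal : finType := option ((option Sigma + N) * Q * Q)%type.
Local Notation sym' := (symbol Omega image_nonterminal).

Definition between (X : option Sigma + N) (p q : Q) : sym' := inr (Some (X, p, q)).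

Definition label (X : symbol Sigma N) : option Sigma + N :=
  match X with inl a => inl (Some a) | inr A => inr A end.

(** The closing [between (inl None) p q] absorbs output emitted without reading after the last
    symbol; in particular, an empty conjunct may translate to a non-empty output. *)
Fixpoint translations (p : Q) (xs : seq (symbol Sigma N)) (q : Q) :
    seq (seq sym') :=
  if xs is X :: xs' then
    [seq between (label X) p r :: ys | r <- enum Q, ys <- translations r xs' q]
  else [:: [:: between (inl None) p q]].

(** For the conjuncts with context operators: their strings begin at the left end of the input, so
    the run begins in an initial state. *)
Definition initial_translations (xs : seq (symbol Sigma N)) (q : Q) :
    seq (seq sym') :=
  flatten [seq translations p xs q | p <- enum (initial T)].

Definition plain_rule (A : image_nonterminal) (w : seq sym') :
    rule Omega image_nonterminal :=
  Rule A [:: w] [::] [::].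

Definition start_rules : seq (rule Omega image_nonterminal) :=
  [seq plain_rule None [:: between (inr (start G)) p q]
  | p <- enum (initial T), q <- enum (accepting T)].

Definition epsilon_rules : seq (rule Omega image_nonterminal) :=
  [seq plain_rule (Some (inl None, p, p)) [::] | p <- enum Q].

(** Here [x.1] is a transition and [x.2] is [(o, o', q)], where [o] and [o'] are what remains to be
    read before and after that transition on the way to [q]. *)
Definition step_rules : seq (rule Omega image_nonterminal) :=
  [seq plain_rule (Some (inl x.2.1.1, x.1.1.1.1, x.2.2))
         (map inl (seq_of_opt x.1.1.2) ++ [:: between (inl x.2.1.2) x.1.2 x.2.2])
  | x <- enum [set x : (Q * option Sigma * option Omega * Q) *
                       (option Sigma * option Sigma * Q) |
               (x.1 \in delta T) &&
               (seq_of_opt x.2.1.1 == seq_of_opt x.1.1.1.2 ++ seq_of_opt x.2.1.2)]].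

(** The left context leads to [pq.1] and the whole prefix to [pq.2]; hence the end states for the
    two kinds of context conjuncts. *)
Definition translated_rules (r : rule Sigma N) (pq : Q * Q) :
    seq (rule Omega image_nonterminal) :=
  [seq Rule (Some (inr (lhs r), pq.1, pq.2)) bs les.1 les.2
  | bs <- choices [seq translations pq.1 a pq.2 | a <- base_conjs r],
    les <- [seq (ls, es)
           | ls <- choices [seq initial_translations b pq.1 | b <- left_conjs r],
             es <- choices [seq initial_translations c pq.2 | c <- extleft_conjs r]]].

Definition image_rules : seq (rule Omega image_nonterminal) :=
  start_rules ++ epsilon_rules ++ step_rules ++
  flatten [seq translated_rules r pq | r <- rules G, pq <- enum {: Q * Q}].

Variant image_rule_spec : rule Omega image_nonterminal -> Prop :=
| StartRule p q : p \in initial T -> q \in accepting T ->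
    image_rule_spec (plain_rule None [:: between (inr (start G)) p q])
| EpsilonRule p : image_rule_spec (plain_rule (Some (inl None, p, p)) [::])
| StepRule p a b r o o' q : (p, a, b, r) \in delta T ->
    seq_of_opt o = seq_of_opt a ++ seq_of_opt o' ->
    image_rule_spec (plain_rule (Some (inl o, p, q))
      (map inl (seq_of_opt b) ++ [:: between (inl o') r q]))
| TranslatedRule r p q bs ls es : r \in rules G ->
    bs \in choices [seq translations p a q | a <- base_conjs r] ->
    ls \in choices [seq initial_translations b p | b <- left_conjs r] ->
    es \in choices [seq initial_translations c q | c <- extleft_conjs r] ->
    image_rule_spec (Rule (Some (inr (lhs r), p, q)) bs ls es).

Lemma image_rulesP r : r \in image_rules <-> image_rule_spec r.
Proof.
rewrite !mem_cat; split.
  case/or4P.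
  - case/allpairsP=> -[p q] [/=]; rewrite !mem_enum => pI qF ->.
    exact: StartRule.
  - by case/mapP=> p _ ->; exact: EpsilonRule.
  - case/mapP=> -[[[[p a] b] s] [[o o'] q]]; rewrite mem_enum inE /=.
    by case/andP=> tT /eqP oE ->; apply: (StepRule (a := a)).
  - case/flattenP=> rs /allpairsP[[s [p q]] [/= sG _ ->]].
    case/allpairsP=> -[bs les] [/= bsP /allpairsP[[ls es] [/= lsP esP ->]] ->].
    exact: TranslatedRule.
case=> [p q pI qF|p|p a b s o o' q tT oE|s p q bs ls es sG bsP lsP esP]; apply/or4P.
- by apply: Or41; apply/allpairsP; exists (p, q); rewrite !mem_enum.
- by apply: Or42; apply: map_f; rewrite mem_enum.
- apply: Or43; apply/mapP; exists ((p, a, b, s), (o, o', q)) => //.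
  by rewrite mem_enum inE tT oE /=.
- apply: Or44; apply/flattenP; exists (translated_rules s (p, q)).
    by apply/allpairsP; exists (s, (p, q)); rewrite mem_enum.
  apply/allpairsP; exists (bs, (ls, es)); split=> //.
  by apply/allpairsP; exists (ls, es).
Qed.

Lemma image_base_gt0 r : r \in image_rules -> 0 < size (base_conjs r).
Proof.
case/image_rulesP=> //= s p q bs ls es sG /size_choices-> _ _.
by rewrite size_map; exact: base_gt0.
Qed.

Definition image_grammar : grammar Omega :=
  Grammar None image_base_gt0.
Local Notation G' := image_grammar.

Lemma derivable_plain (A : nonterminal G') w u v :
  plain_rule A w \in image_rules -> word_holds (@derivable Omega G') u w v ->
  derivable (inr A : symbol Omega (nonterminal G')) u v.
Proof.
move=> rG' H; apply: (derivable_by_rule (G := G') rG') => //= a.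
by rewrite inE => /eqP->.
Qed.

Lemma word_holds_opt_cons (P : sym' -> seq Omega -> seq Omega -> Prop) b X x z y :
  (forall c x', P (inl c) x' [:: c]) ->
  P X (x ++ seq_of_opt b) y -> z = seq_of_opt b ++ y ->
  word_holds P x (map inl (seq_of_opt b) ++ [:: X]) z.
Proof.
move=> Hax HX ->; case: b HX => [b|] /= HX.
  exists [:: b], y; split=> //; exists y, [::]; rewrite cats0; split=> //.
by exists y, [::]; split; rewrite ?cats0 // in HX *.
Qed.

Lemma label_derivable o p q x y :
  transduces p (seq_of_opt o) y q ->
  derivable (between (inl o) p q : symbol Omega (nonterminal G')) x y.
Proof.
case=> ts [Hts oE <-]; elim: ts o p x Hts oE => [|t ts IH] o p x.
  move=> /= /eqP<-; case: o => // _.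
  by apply: (@derivable_plain _ [::]) => //; apply/image_rulesP; exact: EpsilonRule.
rewrite reads_cons; case: t => -[[p' a] b] r /and3P[tT /eqP<- Hts] oE.
(* As [t :: ts] reads at most one symbol, so does [ts]; its head, if any, is the [o'] of the step
   rule. *)
have tsE : reads ts = seq_of_opt (ohead (reads ts)).
  by move: (congr1 size oE); case: (o) (a) (reads ts) => [?|] [?|] [|? []].
have rP := StepRule q tT (etrans (esym oE) (congr1 _ tsE)).
apply: derivable_plain (proj2 (image_rulesP _) rP) _.
apply: word_holds_opt_cons (emits_cons _ _) => //; first exact: derivable_axiom.
exact: IH.
Qed.

(** Quantified over all computations on [u] and [v], since the symbols of a conjunct are read from
    intermediate states and after longer outputs. *)
Definition translatable (X : symbol Sigma N) (u v : seq Sigma) : Prop :=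
  forall x y p q, reached u x p -> transduces p v y q ->
  derivable (between (label X) p q : symbol Omega (nonterminal G')) x y.

(** Cutting the computation at the borders of the partition of [v] yields the states that select the
    translation. *)
Lemma word_translatable xs u v x y p q :
  word_holds translatable u xs v -> reached u x p -> transduces p v y q ->
  exists2 ys, ys \in translations p xs q & word_holds (@derivable _ G') x ys y.
Proof.
elim: xs u v x y p => [|X xs IH] u v x y p /=.
  move=> -> _ Hy; exists [:: between (inl None) p q]; first by rewrite inE.
  exists y, [::]; rewrite cats0; split=> //; exact: label_derivable.
move=> [v1 [v2 [-> HX Hxs]]] Hp /transduces_split[y1 [y2 [r [-> H1 H2]]]].
have [ys ysP Hys] := IH _ _ _ _ _ Hxs (reached_cat Hp H1) H2.
exists (between (label X) p r :: ys).
  by apply/allpairsPdep; exists r, ys; rewrite mem_enum.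
by exists y1, y2; split=> //; exact: HX H1.
Qed.

Lemma initial_word_translatable xs u x q :
  word_holds translatable [::] xs u -> reached u x q ->
  exists2 ys, ys \in initial_translations xs q &
    word_holds (@derivable _ G') [::] ys x.
Proof.
move=> Hxs [p pI Hp].
have [ys ysP Hys] := word_translatable Hxs (reached_nil pI) Hp.
by exists ys => //; apply/flatten_mapP; exists p; rewrite ?mem_enum.
Qed.

Lemma derivable_translatable X u v : derivable X u v -> translatable X u v.
Proof.
have sub xs u' v' :
    word_holds (fun Y u v => derivable Y u v /\ translatable Y u v) u' xs v' ->
    word_holds translatable u' xs v' by apply: word_holds_sub => ? ? ? [].
move: X u v; apply: derivable_nested_ind.
  by move=> a u x y p q _ H; exact: (label_derivable (o := Some a)).
move=> r u v rG Hb Hl He x y p q Hp Hv.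
have [bs bsP Hbs] := proj1 (choicesP (fun a => translations p a q)
  (fun ys => word_holds (@derivable _ G') x ys y) _)
  (fun a ar => word_translatable (sub _ _ _ (Hb a ar)) Hp Hv).
have [ls lsP Hls] := proj1 (choicesP (initial_translations^~ p)
  (fun ys => word_holds (@derivable _ G') [::] ys x) _)
  (fun b br => initial_word_translatable (sub _ _ _ (Hl b br)) Hp).
have [es esP Hes] := proj1 (choicesP (initial_translations^~ q)
  (fun ys => word_holds (@derivable _ G') [::] ys (x ++ y)) _)
  (fun c cr => initial_word_translatable (sub _ _ _ (He c cr)) (reached_cat Hp Hv)).
have rP := proj2 (image_rulesP _) (TranslatedRule rG bsP lsP esP).
exact: (derivable_by_rule (G := G') rP).
Qed.

(** * From derivations in the image grammar back to [G] *)

(* The first component for [inr A] is needed before the second one: it shows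
   that the states between the symbols of a conjunct are productive. *)
Definition decodable (X : sym') (x y : seq Omega) : Prop :=
  match X with
  | inl b => y = [:: b]
  | inr None => x = [::] -> nft_image T (language G) y
  | inr (Some (inl o, p, q)) => transduces p (seq_of_opt o) y q
  | inr (Some (inr A, p, q)) =>
      (exists v, transduces p v y q) /\
      (forall u, reached u x p -> productive q ->
       exists2 v, transduces p v y q & derivable (inr A : symbol Sigma N) u v)
  end.

Lemma decodable_between X x p q y :
  decodable (between (label X) p q) x y ->
  (exists v, transduces p v y q) /\
  (forall u, reached u x p -> productive q ->
   exists2 v, transduces p v y q & derivable X u v).
Proof.
case: X => [a|A] //= H; split; first by exists [:: a].
by move=> u _ _; exists [:: a] => //; exact: derivable_axiom.
Qed.

(** Only the unconditional halves of [decodable] enter, so this applies to the rest of a conjunct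
    before the input read so far is known. *)
Lemma word_run xs ys x y p q :
  word_holds decodable x ys y -> ys \in translations p xs q ->
  exists v, transduces p v y q.
Proof.
elim: xs ys x y p => [|X xs IH] ys x y p /=.
  move/[swap]; rewrite inE => /eqP->; case=> y1 [y2 [-> H ->]].
  by exists [::]; rewrite cats0.
move/[swap]=> /allpairsPdep[r [ws [_ wsP ->]]].
case=> y1 [y2 [-> /decodable_between[[v1 Hv1] _] /IH/(_ wsP)[v2 Hv2]]].
by exists (v1 ++ v2); exact: transduces_cat Hv2.
Qed.

Lemma word_decodable xs ys u x y p q :
  word_holds decodable x ys y -> ys \in translations p xs q ->
  reached u x p -> productive q ->
  exists2 v, transduces p v y q & word_holds (@derivable _ G) u xs v.
Proof.
elim: xs ys u x y p => [|X xs IH] ys u x y p /=.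
  move/[swap]; rewrite inE => /eqP->; case=> y1 [y2 [-> H ->]] _ _.
  by exists [::] => //; rewrite cats0.
move/[swap]=> /allpairsPdep[r [ws [_ wsP ->]]].
case=> y1 [y2 [-> /decodable_between[_ HX] Hws]] Hp Hq.
have [v' Hv'] := word_run Hws wsP.
(* The run on the remaining symbols carries productivity from [q] back to [r]. *)
have [v1 H1 HX1] := HX _ Hp (productive_pred Hv' Hq).
have [v2 H2 Hxs] := IH _ _ _ _ _ Hws wsP (reached_cat Hp H1) Hq.
exists (v1 ++ v2); first exact: transduces_cat H1 H2.
by exists v1, v2.
Qed.

Lemma initial_word_decodable xs ys x q :
  word_holds decodable [::] ys x -> ys \in initial_translations xs q ->
  productive q ->
  exists2 u, reached u x q & word_holds (@derivable _ G) [::] xs u.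
Proof.
move=> Hys /flatten_mapP[p]; rewrite mem_enum => pI ysP Hq.
have [u Hu Hxs] := word_decodable Hys ysP (reached_nil pI) Hq.
by exists u => //; exists p.
Qed.

Hypothesis T_inj : nft_injective T.

Lemma derivable_decodable (X : symbol Omega (nonterminal G')) x y :
  derivable X x y -> decodable X x y.
Proof.
have sub ys u' v' :
    word_holds (fun (Y : symbol Omega (nonterminal G')) u v =>
      derivable Y u v /\ decodable Y u v) u' ys v' ->
    word_holds decodable u' ys v' by apply: word_holds_sub => ? ? ? [].
move: X x y; apply: derivable_nested_ind => // r0 x y.
move=> /image_rulesP[p q pI qF|p|p a b r o o' q tT oE|r p q bs ls es rG bsP lsP esP] Hb Hl He /=.
- move=> x0; have := sub _ _ _ (Hb _ (mem_head _ _)).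
  case=> y1 [y2 [-> [_ H] ->]]; rewrite cats0; rewrite x0 in H.
  (* The empty left context decodes to the empty string at the initial state [p], and the accepting
     [q] is productive by the empty computation. *)
  have [|v Hv HS] := H [::] (reached_nil pI).
    by exists [::], [::], q => //; exact: transduces_nil.
  by exists v; split=> //; exists p, q.
- by have /= -> := Hb _ (mem_head _ _); exact: transduces_nil.
- rewrite oE; have := sub _ _ _ (Hb _ (mem_head _ _)).
  case: b tT {Hb Hl He} => [b|] tT /=.
    case=> y1 [y2 [-> -> [y3 [y4 [-> H ->]]]]]; rewrite cats0.
    exact: transduces_step tT H.
  case=> y3 [y4 [-> H ->]]; rewrite cats0.
  exact: transduces_step tT H.
have Hb' := proj2 (choicesP (fun a => translations p a q)
  (fun ys => word_holds decodable x ys y) _)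
  (ex_intro2 _ _ bs bsP (fun ys h => sub _ _ _ (Hb ys h))).
have Hl' := proj2 (choicesP (initial_translations^~ p)
  (fun ys => word_holds decodable [::] ys x) _)
  (ex_intro2 _ _ ls lsP (fun ys h => sub _ _ _ (Hl ys h))).
have He' := proj2 (choicesP (initial_translations^~ q)
  (fun ys => word_holds decodable [::] ys (x ++ y)) _)
  (ex_intro2 _ _ es esP (fun ys h => sub _ _ _ (He ys h))).
(* A rule has at least one base conjunct; its decoding supplies the [v] with which all others are
   compared. *)
have /hasP[a0 a0r _] : has predT (base_conjs r) by rewrite has_predT; exact: base_gt0.
have [ys0 ys0P Hys0] := Hb' a0 a0r.
split; first exact: word_run Hys0 ys0P.
move=> u Hu Hq.
have [v Hv _] := word_decodable Hys0 ys0P Hu Hq.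
have Hp := productive_pred Hv Hq.
exists v => //; apply: derivable_by_rule => //.
(* Each conjunct brings its own decoding; unique decoding at [q], or at [p] for left contexts,
   identifies it with [v], [u] or [u ++ v]. *)
- move=> a /Hb'[ys ysP Hys]; have [v' Hv'] := word_decodable Hys ysP Hu Hq.
  by rewrite (transduces_inj T_inj Hu Hq Hv Hv').
- move=> b /Hl'[ys ysP Hys]; have [u' Hu'] := initial_word_decodable Hys ysP Hp.
  by rewrite (reached_inj T_inj Hu Hu' Hp).
- move=> c /He'[ys ysP Hys]; have [w Hw] := initial_word_decodable Hys ysP Hq.
  by rewrite (reached_inj T_inj (reached_cat Hu Hv) Hw Hq).
Qed.

End ImageGrammar.

Theorem theorem3 (Sigma Omega : finType) (T : nft Sigma Omega)
    (T_inj : nft_injective T) (G : grammar Sigma) :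
  exists G' : grammar Omega,
    forall z : seq Omega, language G' z <-> nft_image T (language G) z.
Proof.
exists (image_grammar T G) => z; split.
  by move=> /(derivable_decodable T_inj)/(_ erefl).
case=> w [Hw [p [q [pI qF Hz]]]].
apply: (@derivable_plain _ _ T G None [:: between (inr (start G)) p q]).
  by apply/image_rulesP; exact: StartRule.
exists z, [::]; rewrite cats0; split=> //.
exact: (derivable_translatable Hw (reached_nil pI) Hz).
Qed.
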